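(* For every real number $r\in\mathbb{R}$ there exists an admissible chain complex $C$ of $R$-modules with $\chi_{\mathrm H}(C)=r$.
   Context: $R$ is an arbitrary unital commutative Noetherian integral domain with field of fractions $Q$; $\mathbb{N}=\{1,2,3,\dots\}$. The rank of an $R$-module $A$ is $\mathrm{rank}\,A=\dim_Q(A\otimes_R Q)$. Let $M=(m_{i,j})_{i,j\in\mathbb{N}}$ be the Cesàro matrix: $m_{i,j}=1/i$ if $i\ge j$ and $m_{i,j}=0$ otherwise. A real sequence $\mathbf a=(a_n)_{n\in\mathbb{N}}$ is H-convergent if $M^k\mathbf a$ converges for some integer $k>0$; its H-limit $\mathrm{H}\text{-}\lim\mathbf a$ is $\lim M^k\mathbf a$ for sufficiently large $k$ (if $M^k\mathbf a$ converges then $M^m\mathbf a$ converges to the same limit for all $m\ge k$). An H-null sequence is an H-convergent sequence with H-limit $0$. A chain complex $C$ of $R$-modules is pre-admissible if $C_n=0$ for $n<0$, all homology modules $H_nC$ are finitely generated, and the sequence $\mathbf HC=\big((-1)^{n-1}\,\mathrm{rank}\,H_{n-1}C\big)_{n\in\mathbb{N}}$ is H-convergent. Its infinite Euler characteristic is $\chi_{\mathrm H}(C)=\mathrm{H}\text{-}\lim\mathbf HC$. A pre-admissible complex $C$ is admissible if, in addition, the sequence $\big(\tfrac1n\mathrm{rank}\,H_{n-1}C\big)_{n\in\mathbb{N}}$ is H-null. *)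

(* Defs.v *)
From HB Require Import structures.
From mathcomp Require Import all_boot all_order all_algebra.
From mathcomp Require Import generic_quotient ring_quotient.
From mathcomp Require Import freeg.
From mathcomp Require Import all_classical all_reals all_analysis.

Set Implicit Arguments.
Unset Strict Implicit.
Unset Printing Implicit Defensive.

Import Order.TTheory GRing.Theory Num.Theory.
Import numFieldNormedType.Exports.

Local Open Scope classical_set_scope.
Local Open Scope ring_scope.
Local Open Scope quotient_scope.

Definition fin_gen (R : nzRingType) (A : lmodType R) : Prop :=
  exists (n : nat) (e : 'I_n -> A),
    forall a : A, exists c : 'I_n -> R, a = \sum_i c i *: e i.

Record is_ideal (R : comNzRingType) (I : set R) : Prop := IsIdeal {
  ideal0 : I 0;
  idealD : forall x y, I x -> I y -> I (x + y);
  idealM : forall a x, I x -> I (a * x)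
}.

Definition noetherian (R : comNzRingType) : Prop :=
  forall I : set R, is_ideal I ->
    exists (n : nat) (e : 'I_n -> R),
      I = [set x | exists c : 'I_n -> R, x = \sum_i c i * e i].

Section QuotientModule.
Context (R : nzRingType) (M : lmodType R) (I : submodClosed M).

(* submodClosed is shared with semimodules and does not provide closure under
   opposite, which Quotient.quot needs. *)
Definition zmod_of_submod : {pred M} := [pred x | x \in I].

Fact zmod_of_submod_zmod : zmod_closed zmod_of_submod.
Proof.
split=> [|x y]; rewrite !inE ?rpred0 // => Ix Iy.
by rewrite rpredD // -scaleN1r rpredZ.
Qed.

HB.instance Definition _ := GRing.isZmodClosed.Build M zmod_of_submod
  zmod_of_submod_zmod.

Definition quot_mod : Type := Quotient.quot zmod_of_submod.

HB.instance Definition _ := GRing.Zmodule.on quot_mod.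

Definition quot_mod_pi (x : M) : quot_mod := \pi_(Quotient.quot zmod_of_submod) x.

Definition quot_mod_scale (a : R) (u : quot_mod) : quot_mod :=
  quot_mod_pi (a *: repr (u : Quotient.quot zmod_of_submod)).

Lemma quot_mod_piE x y : (quot_mod_pi x = quot_mod_pi y) <-> (x - y \in I).
Proof.
have -> : (x - y \in I) = (x - y \in zmod_of_submod) by [].
by rewrite Quotient.idealrBE; split => /eqP.
Qed.

Lemma quot_mod_piD x y : quot_mod_pi (x + y) = quot_mod_pi x + quot_mod_pi y.
Proof. by rewrite /quot_mod_pi pi_addr. Qed.

Lemma quot_mod_piK (u : quot_mod) : quot_mod_pi (repr (u : Quotient.quot zmod_of_submod)) = u.
Proof. by rewrite /quot_mod_pi reprK. Qed.

Lemma quot_mod_piZ a x : quot_mod_pi (a *: x) = quot_mod_scale a (quot_mod_pi x).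
Proof.
apply/quot_mod_piE; rewrite -scalerBr rpredZ //.
by apply/quot_mod_piE; rewrite quot_mod_piK.
Qed.

Fact quot_mod_scaleA a b u :
  quot_mod_scale a (quot_mod_scale b u) = quot_mod_scale (a * b) u.
Proof. by rewrite -[u]quot_mod_piK -!quot_mod_piZ scalerA. Qed.

Fact quot_mod_scale1 : left_id 1 quot_mod_scale.
Proof. by move=> u; rewrite -[u]quot_mod_piK -quot_mod_piZ scale1r. Qed.

Fact quot_mod_scaleDr : right_distributive quot_mod_scale +%R.
Proof.
move=> a u v; rewrite -[u]quot_mod_piK -[v]quot_mod_piK.
by rewrite -quot_mod_piD -!quot_mod_piZ scalerDr quot_mod_piD.
Qed.

Fact quot_mod_scaleDl u : {morph quot_mod_scale^~ u : a b / a + b}.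
Proof.
move=> a b; rewrite -[u]quot_mod_piK -!quot_mod_piZ scalerDl.
by rewrite quot_mod_piD.
Qed.

HB.instance Definition _ := GRing.Zmodule_isLmodule.Build R quot_mod
  quot_mod_scaleA quot_mod_scale1 quot_mod_scaleDr quot_mod_scaleDl.

Fact quot_mod_pi_is_linear : linear quot_mod_pi.
Proof. by move=> a x y; rewrite quot_mod_piD quot_mod_piZ. Qed.

HB.instance Definition _ := GRing.isLinear.Build R M quot_mod *:%R quot_mod_pi
  quot_mod_pi_is_linear.

End QuotientModule.

Section KernelModImage.
Context (R : nzRingType) (U V W : lmodType R).
Context (g : {linear U -> V}) (f : {linear V -> W}).

Definition ker_pred : {pred V} := [pred x | f x == 0].

Fact ker_pred_submod : submod_closed ker_pred.
Proof.
split=> [|a x y]; rewrite !inE ?linear0 // => /eqP fx /eqP fy.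
by rewrite linearP fx fy scaler0 addr0.
Qed.

HB.instance Definition _ := GRing.isSubmodClosed.Build R V ker_pred
  ker_pred_submod.

Definition ker_mod : Type := {x : V | x \in ker_pred}.

HB.instance Definition _ := SubChoice.on ker_mod.
HB.instance Definition _ := [SubChoice_isSubLmodule of ker_mod by <:].

Definition im_pred : {pred ker_mod} :=
  [pred z : ker_mod | `[< exists y : U, g y = \val z >]].

Fact im_pred_submod : submod_closed im_pred.
Proof.
split=> [|a x y]; first by apply/asboolP; exists 0; rewrite !raddf0.
move=> /asboolP[u gu] /asboolP[v gv]; apply/asboolP; exists (a *: u + v).
by rewrite linearP gu gv.
Qed.

HB.instance Definition _ := GRing.isSubmodClosed.Build R ker_mod im_pred
  im_pred_submod.

Definition ker_mod_im : lmodType R := quot_mod im_pred.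

End KernelModImage.

(* Chain complexes indexed by the integers.  A differential is given between
   any two degrees and required to vanish unless it lowers the degree by one,
   which avoids transports along equalities of degrees such as n + 1 - 1 = n. *)
Record chain_complex (R : nzRingType) := ChainComplex {
  chain :> int -> lmodType R;
  chain_diff : forall i j : int, {linear chain i -> chain j};
  chain_diff_shape : forall i j : int, i != j + 1 -> forall x, chain_diff i j x = 0;
  chain_diffK : forall (i j k : int) x, chain_diff j k (chain_diff i j x) = 0
}.

Definition homology (R : nzRingType) (C : chain_complex R) (n : int) :
    lmodType R :=
  ker_mod_im (chain_diff C (n + 1) n) (chain_diff C n (n - 1)).

(* The tensor product of A with S over R, where S is an R-module through f:
   the free abelian group on A * S modulo the usual relations.  It is an
   S-module through the action of S on the right factor. *)
Section Tensor.
Context (R S : comNzRingType) (f : {rmorphism R -> S}) (A : lmodType R).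

Local Notation free := {freeg (A * S)%type / int}.
Local Notation "<[ a , s ]>" := (<< (a, s) >> : free).

Inductive tensor_relator : free -> Prop :=
| TensorDl a b s : tensor_relator (<[a + b, s]> - <[a, s]> - <[b, s]>)
| TensorDr a s t : tensor_relator (<[a, s + t]> - <[a, s]> - <[a, t]>)
| TensorZ r a s : tensor_relator (<[r *: a, s]> - <[a, f r * s]>).

Inductive tensor_relation : free -> Prop :=
| TensorRel x of tensor_relator x : tensor_relation x
| TensorRel0 : tensor_relation 0
| TensorRelB x y of tensor_relation x & tensor_relation y :
    tensor_relation (x - y).

Definition tensor_pred : {pred free} := [pred x | `[< tensor_relation x >]].

Fact tensor_pred_zmod : zmod_closed tensor_pred.
Proof.
split=> [|x y]; first exact/asboolP/TensorRel0.
by move=> /asboolP rx /asboolP ry; apply/asboolP; exact: TensorRelB.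
Qed.

HB.instance Definition _ := GRing.isZmodClosed.Build free tensor_pred
  tensor_pred_zmod.

Definition tensor : Type := Quotient.quot tensor_pred.

HB.instance Definition _ := GRing.Zmodule.on tensor.

Definition tensor_pi (x : free) : tensor := \pi_(Quotient.quot tensor_pred) x.

Definition pure_tensor (a : A) (s : S) : tensor := tensor_pi <[a, s]>.

Lemma tensor_piE x y : tensor_pi x = tensor_pi y <-> tensor_relation (x - y).
Proof.
have E := Quotient.idealrBE tensor_pred x y; split=> [/eqP xy | rxy].
  by apply/asboolP; rewrite -[asbool _]/(x - y \in tensor_pred) E.
by apply/eqP; rewrite -[_ == _]E; exact/asboolP.
Qed.

Lemma tensor_piK (u : tensor) :
  tensor_pi (repr (u : Quotient.quot tensor_pred)) = u.
Proof. by rewrite /tensor_pi reprK. Qed.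

Fact tensor_pi_is_zmod_morphism : zmod_morphism tensor_pi.
Proof. by move=> x y; rewrite /tensor_pi pi_addr pi_oppr. Qed.

HB.instance Definition _ := GRing.isZmodMorphism.Build free tensor tensor_pi
  tensor_pi_is_zmod_morphism.

Definition free_scale (s : S) : free -> free :=
  fglift (fun x : A * S => <[x.1, s * x.2]>).

Fact free_scale_is_zmod_morphism s : zmod_morphism (free_scale s).
Proof. exact: lift_is_additive. Qed.

HB.instance Definition _ s := GRing.isZmodMorphism.Build free free
  (free_scale s) (free_scale_is_zmod_morphism s).

Lemma free_scale_gen s a t : free_scale s <[a, t]> = <[a, s * t]>.
Proof. by rewrite /free_scale liftU scale1r. Qed.

Lemma free_ind (P : free -> Prop) :
  P 0 -> (forall x y, P x -> P y -> P (x - y)) ->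
  (forall a s, P <[a, s]>) -> forall x, P x.
Proof.
move=> P0 PB Pgen x.
have PN y : P y -> P (- y) by move=> Py; rewrite -sub0r; exact: PB.
have PD y z : P y -> P z -> P (y + z).
  by move=> Py Pz; rewrite -[z]opprK; apply: PB => //; exact: PN.
rewrite -[x]freeg_sumE; apply: big_ind => // -[a s] _.
have Pn n : P (<[a, s]> *+ n).
  by elim: n => [|n IHn]; rewrite ?mulr0n ?mulrS //; exact: PD.
have -> : << coeff (a, s) x *g (a, s) >> = <[a, s]> *~ coeff (a, s) x.
  by rewrite freeg_mulz intz.
by case: (coeff _ _) => n; [exact: Pn | exact/PN/Pn].
Qed.

Lemma free_scale_relation s x :
  tensor_relation x -> tensor_relation (free_scale s x).
Proof.
elim=> {x} [x [a b t|a t u|r a t]||x y _ IHx _ IHy].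
- rewrite !raddfB /= !free_scale_gen; exact/TensorRel/TensorDl.
- rewrite !raddfB /= !free_scale_gen mulrDr; exact/TensorRel/TensorDr.
- rewrite raddfB /= !free_scale_gen mulrCA; exact/TensorRel/TensorZ.
- rewrite raddf0; exact: TensorRel0.
- rewrite raddfB; exact: TensorRelB.
Qed.

Definition tensor_scale (s : S) (u : tensor) : tensor :=
  tensor_pi (free_scale s (repr (u : Quotient.quot tensor_pred))).

Lemma tensor_scale_pi s x : tensor_scale s (tensor_pi x) = tensor_pi (free_scale s x).
Proof.
apply/tensor_piE; rewrite -raddfB; apply: free_scale_relation.
by apply/tensor_piE; rewrite tensor_piK.
Qed.

Fact tensor_scaleA s t u :
  tensor_scale s (tensor_scale t u) = tensor_scale (s * t) u.
Proof.
rewrite -[u]tensor_piK !tensor_scale_pi; congr tensor_pi.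
elim/free_ind: (repr _) => [|x y IHx IHy|a r]; first by rewrite !raddf0.
  by rewrite !raddfB /= IHx IHy.
by rewrite !free_scale_gen mulrA.
Qed.

Fact tensor_scale1 : left_id 1 tensor_scale.
Proof.
move=> u; rewrite -[u]tensor_piK tensor_scale_pi; congr tensor_pi.
elim/free_ind: (repr _) => [|x y IHx IHy|a r]; first by rewrite raddf0.
  by rewrite raddfB /= IHx IHy.
by rewrite free_scale_gen mul1r.
Qed.

Fact tensor_scaleDr : right_distributive tensor_scale +%R.
Proof.
move=> s u v; rewrite -[u]tensor_piK -[v]tensor_piK -raddfD !tensor_scale_pi.
by rewrite !raddfD.
Qed.

Fact tensor_scaleDl u : {morph tensor_scale^~ u : s t / s + t}.
Proof.
move=> s t; rewrite -[u]tensor_piK !tensor_scale_pi.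
elim/free_ind: (repr _) => [|x y IHx IHy|a r]; first by rewrite !raddf0 addr0.
  by rewrite !raddfB /= IHx IHy opprD addrACA.
rewrite !free_scale_gen -raddfD; apply/tensor_piE.
by rewrite mulrDl opprD addrA; exact/TensorRel/TensorDr.
Qed.

HB.instance Definition _ := GRing.Zmodule_isLmodule.Build S tensor
  tensor_scaleA tensor_scale1 tensor_scaleDr tensor_scaleDl.

Lemma pure_tensorDl a b s : pure_tensor (a + b) s = pure_tensor a s + pure_tensor b s.
Proof.
by rewrite /pure_tensor -raddfD; apply/tensor_piE; rewrite opprD addrA;
  exact/TensorRel/TensorDl.
Qed.

Lemma pure_tensorDr a s t : pure_tensor a (s + t) = pure_tensor a s + pure_tensor a t.
Proof.
by rewrite /pure_tensor -raddfD; apply/tensor_piE; rewrite opprD addrA;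
  exact/TensorRel/TensorDr.
Qed.

Lemma pure_tensorZ r a s : pure_tensor (r *: a) s = pure_tensor a (f r * s).
Proof. exact/tensor_piE/TensorRel/TensorZ. Qed.

Lemma scale_pure_tensor s a t : s *: pure_tensor a t = pure_tensor a (s * t).
Proof. by rewrite /pure_tensor [LHS]tensor_scale_pi free_scale_gen. Qed.

End Tensor.

Definition is_basis (F : fieldType) (V : lmodType F) (n : nat)
    (e : 'I_n -> V) : Prop :=
  (forall c : 'I_n -> F, \sum_i c i *: e i = 0 -> forall i, c i = 0) /\
  (forall v : V, exists c : 'I_n -> F, v = \sum_i c i *: e i).

(* The value is the default 0 when V is infinite-dimensional. *)
Definition dimension (F : fieldType) (V : lmodType F) : nat :=
  get [set n | exists e : 'I_n -> V, is_basis e].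

Definition module_rank (R : idomainType) (A : lmodType R) : nat :=
  dimension (tensor (@FracField.tofrac R : {rmorphism R -> {fraction R}}) A).

(* Sequences are indexed from 0: the entry at index n of a : K^nat is the entry
   with index n + 1 in the usual indexing by positive integers, and likewise
   for the rows and columns of infinite matrices. *)
Section Holder.
Context (K : realType).

Definition cesaro_mx (i j : nat) : K :=
  if (j <= i)%N then i.+1%:R^-1 else 0.

(* Row i of the matrix is supported on the columns j <= i. *)
Definition cesaro_mul (a : K^nat) : K^nat :=
  fun i => \sum_(j < i.+1) cesaro_mx i j * a j.

Definition H_convergent (a : K^nat) : Prop :=
  exists2 k : nat, (0 < k)%N & cvg (iter k cesaro_mul a @ \oo).

Definition is_Hlim (a : K^nat) (l : K) : Prop :=
  \forall k \near \oo, iter k cesaro_mul a @ \oo --> l.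

Definition Hlim (a : K^nat) : K := get (is_Hlim a).

Definition H_null (a : K^nat) : Prop := H_convergent a /\ Hlim a = 0.

End Holder.

Section EulerCharacteristic.
Context (R : idomainType) (K : realType).
Implicit Type C : chain_complex R.

Definition signed_ranks C : K^nat :=
  fun n => (-1) ^+ n * (module_rank (homology C n%:Z))%:R.

Definition pre_admissible C : Prop :=
  [/\ forall n : int, n < 0 -> forall x : C n, x = 0,
      forall n : int, fin_gen (homology C n) &
      H_convergent (signed_ranks C)].

Definition Euler_char C : K := Hlim (signed_ranks C).

Definition admissible C : Prop :=
  pre_admissible C /\
  H_null (fun n => n.+1%:R^-1 * (module_rank (homology C n%:Z))%:R : K).

End EulerCharacteristic.

(* Main.v *)
(* Complexes of free modules with zero differentials realise every sequence
   b_0, b_1, ... of natural numbers as the ranks of their homology modules.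
   Spreading the increments of floor (|r| n) over the positions of one parity
   gives a bounded sequence b whose signed partial sums stay at bounded distance
   from n r, so one application of the Cesaro matrix already converges to r. *)
Require Import Defs.
From mathcomp Require Import all_boot all_order all_algebra.
From mathcomp Require Import generic_quotient ring_quotient freeg.
From mathcomp Require Import all_classical all_reals all_analysis.
From mathcomp Require Import zify lra.

Set Implicit Arguments.
Unset Strict Implicit.
Unset Printing Implicit Defensive.

Import Order.TTheory GRing.Theory Num.Theory.
Import numFieldNormedType.Exports.

Local Open Scope classical_set_scope.
Local Open Scope ring_scope.
Local Open Scope quotient_scope.

(** The two halves of [is_basis], over any ring, so that they also apply to [R]-modules before base
    change. *)
Definition free_family (R : nzRingType) (A : lmodType R) n (e : 'I_n -> A) :=
  forall c : 'I_n -> R, \sum_i c i *: e i = 0 -> forall i, c i = 0.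

Definition spanning_family (R : nzRingType) (A : lmodType R) n (e : 'I_n -> A) :=
  forall a : A, exists c : 'I_n -> R, a = \sum_i c i *: e i.

(** * Invariance of dimension over a field *)

Section Dimension.
Context (F : fieldType) (V : lmodType F).

(** The coordinates of [e] with respect to [g] form an [m] by [n] matrix with independent rows, so
    its rank [m] is at most [n]. *)
Lemma free_le_spanning m n (e : 'I_m -> V) (g : 'I_n -> V) :
  free_family e -> spanning_family g -> (m <= n)%N.
Proof.
move=> e_free g_span.
have [c ec] := choice (fun i => g_span (e i)).
pose A := \matrix_(i, j) c i j.
suff : row_free A by rewrite /row_free => /eqP <-; exact: rank_leq_col.
apply/inj_row_free => v vA0; apply/rowP => i; rewrite mxE.
apply: (e_free (fun i => v 0 i)) => {i}.
under eq_bigr do rewrite ec scaler_sumr.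
rewrite exchange_big big1 //= => j _.
under eq_bigr do rewrite scalerA.
have : (v *m A) 0 j = 0 by rewrite vA0 mxE.
by rewrite -scaler_suml mxE; under eq_bigr do rewrite mxE; move=> ->; rewrite scale0r.
Qed.

Lemma dimension_basis n (e : 'I_n -> V) : is_basis e -> dimension V = n.
Proof.
move=> e_basis; apply: get_unique => [|m [g g_basis]]; first by exists e.
case: e_basis g_basis => ef es [gf gs].
by apply/eqP; rewrite eqn_leq (free_le_spanning gf es) (free_le_spanning ef gs).
Qed.

End Dimension.

(** * Bases under base change *)

Section TensorBasis.
Context (R S : comNzRingType) (f : {rmorphism R -> S}) (A : lmodType R).

Lemma tensor_ind (P : tensor f A -> Prop) :
  P 0 -> (forall u v, P u -> P v -> P (u - v)) ->
  (forall a s, P (pure_tensor f a s)) -> forall u, P u.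
Proof.
move=> P0 PB Pp u; rewrite -[u]tensor_piK.
elim/free_ind: (repr _) => [|x y Px Py|a s]; first by rewrite raddf0.
  by rewrite raddfB; exact: PB.
exact: Pp.
Qed.

Lemma pure_tensor_sum (I : Type) (r : seq I) (F : I -> A) s :
  pure_tensor f (\sum_(i <- r) F i) s = \sum_(i <- r) pure_tensor f (F i) s.
Proof.
apply: (big_morph (fun a => pure_tensor f a s)) => [a b|].
  exact: pure_tensorDl.
by rewrite -(scale0r (0 : A)) pure_tensorZ rmorph0 mul0r -(mul0r (0 : S))
  -scale_pure_tensor scale0r.
Qed.

(** Universal property of base change: the extension of [s * p a] to the free abelian group kills
    the relators, so it descends to the quotient. *)
Lemma tensor_lift (p : A -> S) : {morph p : a b / a + b} ->
  (forall r a, p (r *: a) = f r * p a) ->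
  exists h : tensor f A -> S, [/\ {morph h : u v / u - v},
    forall s u, h (s *: u) = s * h u & forall a s, h (pure_tensor f a s) = s * p a].
Proof.
move=> pD pZ.
pose h0 := fglift (fun x : A * S => (x.2 * p x.1 : zmodule S)).
have h0B : zmod_morphism h0 by exact: lift_is_additive.
have h00 : h0 0 = 0 by rewrite -(subrr 0) h0B subrr.
have h0U a s : h0 << (a, s) >> = s * p a by rewrite /h0 liftU scale1r.
have h0rel x : tensor_relation f x -> h0 x = 0.
  elim=> {x} [x [a b s|a s t|r a s]||x y _ hx _ hy].
  - by rewrite !h0B !h0U pD mulrDr -addrA -opprD subrr.
  - by rewrite !h0B !h0U mulrDl -addrA -opprD subrr.
  - by rewrite !h0B !h0U pZ mulrCA mulrA subrr.
  - exact: h00.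
  - by rewrite h0B hx hy subrr.
pose h (u : tensor f A) : S := h0 (repr (u : Quotient.quot (@tensor_pred R S f A))).
have hpi x : h (tensor_pi f x) = h0 x.
  apply/eqP; rewrite -subr_eq0 /h; apply/eqP.
  rewrite -[LHS]h0B; apply: h0rel; apply/tensor_piE; exact: tensor_piK.
have hB : {morph h : u v / u - v}.
  by move=> u v; rewrite -[u]tensor_piK -[v]tensor_piK -raddfB !hpi h0B.
have hp a s : h (pure_tensor f a s) = s * p a by rewrite hpi h0U.
have h_0 : h 0 = 0 by rewrite -(subrr 0) hB subrr.
exists h; split => // s; elim/tensor_ind => [|u v hu hv|a t].
- by rewrite scaler0 h_0 mulr0.
- by rewrite scalerBr !hB hu hv mulrBr.
- by rewrite scale_pure_tensor !hp mulrA.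
Qed.

Lemma pure_tensor_spanning n (e : 'I_n -> A) :
  spanning_family e -> spanning_family (fun i => pure_tensor f (e i) 1).
Proof.
move=> e_span; elim/tensor_ind => [|u v [c ->] [d ->]|a s].
- by exists (fun=> 0); rewrite big1 // => i _; rewrite scale0r.
- exists (fun i => c i - d i); rewrite -sumrB.
  by apply: eq_bigr => i _; rewrite scalerBl.
- have [c ->] := e_span a; exists (fun i => s * f (c i)).
  rewrite pure_tensor_sum; apply: eq_bigr => i _.
  by rewrite pure_tensorZ scale_pure_tensor mulr1 mulrC.
Qed.

(** Coordinates in a basis are unique, hence linear. The lift of the [j]-th one is a functional that
    reads the [j]-th coefficient off any linear relation between the tensors. *)
Lemma pure_tensor_free n (e : 'I_n -> A) : spanning_family e ->
  free_family e -> free_family (fun i => pure_tensor f (e i) 1).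
Proof.
move=> e_span e_free.
have e_inj (c d : 'I_n -> R) :
    \sum_i c i *: e i = \sum_i d i *: e i -> forall i, c i = d i.
  move=> cd i; apply/eqP; rewrite -subr_eq0; apply/eqP.
  apply: (e_free (fun i => c i - d i)).
  by under eq_bigr do rewrite scalerBl; rewrite sumrB cd subrr.
have [x ex] := choice e_span.
move=> c c0 j.
have [||h [hB hZ hp]] := @tensor_lift (fun a => f (x a j)).
- move=> a b; rewrite -rmorphD; congr (f _).
  apply: (e_inj _ (fun i => x a i + x b i)); rewrite -ex.
  by under [RHS]eq_bigr do rewrite scalerDl; rewrite big_split -!ex.
- move=> r a; rewrite -rmorphM; congr (f _).
  apply: (e_inj _ (fun i => r * x a i)); rewrite -ex.
  by under [RHS]eq_bigr do rewrite -scalerA; rewrite -scaler_sumr -ex.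
have h0 : h 0 = 0 by rewrite -(subrr 0) hB subrr.
have hD : {morph h : u v / u + v}.
  move=> u v; rewrite -[v in LHS]opprK hB -[in LHS](sub0r v) hB h0 sub0r.
  by rewrite opprK.
have xe i : x (e i) j = (i == j)%:R.
  apply: (e_inj _ (fun k => (i == k)%:R)); rewrite -ex.
  rewrite (bigD1 i) //= eqxx scale1r big1 ?addr0 // => k ki.
  by rewrite eq_sym (negPf ki) scale0r.
have := congr1 h c0; rewrite h0 (big_morph h hD h0) => <-.
rewrite (bigD1 j) //= hZ hp xe eqxx rmorph1 !mulr1 big1 ?addr0 // => i ij.
by rewrite hZ hp xe (negPf ij) rmorph0 !mulr0.
Qed.

End TensorBasis.

Lemma module_rank_free (R : idomainType) (A : lmodType R) n (e : 'I_n -> A) :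
  spanning_family e -> free_family e -> module_rank A = n.
Proof.
move=> es ef; apply: (@dimension_basis _ _ _ (fun i => pure_tensor _ (e i) 1)).
by split; [exact: pure_tensor_free|exact: pure_tensor_spanning].
Qed.

(** * Homology of a complex with zero differentials *)

Section ZeroComplex.
Context (R : nzRingType) (b : int -> nat).

Definition zero_complex : chain_complex R :=
  @ChainComplex R (fun n => 'rV[R]_(b n)) (fun i j => \0 : {linear _ -> _})
    (fun i j _ x => erefl) (fun i j k x => erefl).

(** Every chain is a cycle and only 0 is a boundary, so the classes of the standard row vectors form
    a basis. *)
Lemma zero_complex_homology n : exists e : 'I_(b n) -> homology zero_complex n,
  spanning_family e /\ free_family e.
Proof.
pose g := chain_diff zero_complex (n + 1) n.
pose d := chain_diff zero_complex n (n - 1).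
have kerT (x : 'rV[R]_(b n)) : x \in ker_pred d by rewrite inE.
pose inc (x : 'rV[R]_(b n)) : ker_mod d := Sub x (kerT x).
have sum_inc (c : 'I_(b n) -> R) : \sum_i c i *: inc (delta_mx 0 i) =
    inc (\row_i c i).
  apply: val_inj; rewrite raddf_sum [RHS]row_sum_delta /=.
  by apply: eq_bigr => i _; rewrite mxE.
exists (fun i => quot_mod_pi (im_pred g (f := d)) (inc (delta_mx 0 i))).
split=> [u|c].
  rewrite -[u]quot_mod_piK; set x := repr _.
  exists (fun i => val x 0 i).
  under eq_bigr do rewrite -linearZ.
  rewrite -raddf_sum sum_inc; congr quot_mod_pi; apply: val_inj.
  by apply/rowP => i; rewrite mxE.
under eq_bigr do rewrite -linearZ.
rewrite -raddf_sum sum_inc -(raddf0 (quot_mod_pi (im_pred g (f := d)))).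
move=> /quot_mod_piE; rewrite subr0 => /asboolP[y /= /esym c0] i.
by have /rowP/(_ i) := c0; rewrite !mxE.
Qed.

End ZeroComplex.

(** * Iterated Cesaro means *)

Section Cesaro.
Context (K : realType).
Implicit Types (a : K^nat) (l : K).

Lemma cesaro_mulE a n : cesaro_mul a n = n.+1%:R^-1 * \sum_(j < n.+1) a j.
Proof.
rewrite /cesaro_mul mulr_sumr; apply: eq_bigr => j _.
by rewrite /cesaro_mx -ltnS ltn_ord.
Qed.

(** Each further iteration takes arithmetic means, which keep the limit by Cesaro's theorem. *)
Lemma cvg_iter_cesaro_mul a l k m : (k <= m)%N ->
  iter k (@cesaro_mul K) a @ \oo --> l -> iter m (@cesaro_mul K) a @ \oo --> l.
Proof.
move=> /subnK <-; elim: (m - k)%N => // i IHi al.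
rewrite (_ : iter _ _ _ = arithmetic_mean (iter (i + k) (@cesaro_mul K) a)).
  exact/cesaro/IHi.
by apply/funext => n; rewrite /= cesaro_mulE /arithmetic_mean /series /= big_mkord.
Qed.

Lemma cesaro_mul_Hlim a l : cesaro_mul a @ \oo --> l ->
  H_convergent a /\ Hlim a = l.
Proof.
move=> al; split; first by exists 1%N => //; apply/cvg_ex; exists l.
have al1 : is_Hlim a l.
  by exists 1%N => // k /= k1; apply: (cvg_iter_cesaro_mul k1).
apply: (get_unique al1) => l' al'.
(* Both limits are attained by all late iterates, hence by a common one. *)
have [k [kl kl']] : exists k, iter k (@cesaro_mul K) a @ \oo --> l' /\
    iter k (@cesaro_mul K) a @ \oo --> l.
  have [k1 _ h1] := al'; have [k2 _ h2] := al1.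
  exists (maxn k1 k2); split; [apply: h1 | apply: h2].
    exact: leq_maxl.
  exact: leq_maxr.
exact: (cvg_unique _ kl kl').
Qed.

Lemma bounded_div_cvg0 (u : K^nat) (B : K) : (forall n, `|u n| <= B) ->
  (fun n => n.+1%:R^-1 * u n) @ \oo --> (0 : K).
Proof.
move=> uB; apply: norm_cvg0.
apply: (@squeeze_cvgr _ _ _ _ (fun=> 0) (fun n => B * n.+1%:R^-1)).
- apply: nearW => n; rewrite normr_ge0 normrM ger0_norm ?invr_ge0 ?ler0n //=.
  by rewrite mulrC ler_wpM2r ?invr_ge0 ?ler0n.
- exact: cvg_cst.
- rewrite -[X in _ --> X](mulr0 B); apply: cvgMr; exact: cvg_harmonic.
Qed.

(* Up to the sign of r, the n-th partial sum is [truncn (`|r| * m)] with m an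
   even number next to n, chosen so that it only jumps at the positions where
   (-1) ^+ j has the sign of r. *)
Lemma bounded_nat_signed_mean (r : K) : exists (b : nat -> nat) (B : K),
  (forall n, (b n)%:R <= B) /\
  forall n, `|\sum_(j < n) (-1) ^+ j * (b j)%:R - n%:R * r| <= B.
Proof.
pose s := r < 0.
(* The factor is [n] rounded to an even number, upwards if [r >= 0] and downwards if [r < 0]; it
   changes from [n] to [n.+1] only for even [n] in the first case and odd [n] in the second. *)
pose c n := Num.truncn (`|r| * ((n + ~~ s)./2.*2)%:R).
have r0 := normr_ge0 r.
have cleS n : (c n <= c n.+1)%N.
  by apply/le_truncn/ler_wpM2l => //; rewrite ler_nat; lia.
have c0 : c 0%N = 0%N.
  by rewrite /c; case: (~~ s); rewrite /= mulr0 truncn0.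
(* Rounding [n] costs at most [|r|], truncation at most 1. *)
have cB n : `|(c n)%:R - n%:R * `|r| | <= `|r| + 1.
  have h0 : 0 <= `|r| * ((n + ~~ s)./2.*2)%:R by rewrite mulr_ge0.
  have /andP[h1 h2] := truncn_itv h0.
  have g1 : (((n + ~~ s)./2.*2)%:R : K) <= n%:R + 1.
    by rewrite natr1 ler_nat; case: (~~ s); lia.
  have g2 : (n%:R : K) <= ((n + ~~ s)./2.*2)%:R + 1.
    by rewrite natr1 ler_nat; case: (~~ s); lia.
  have {}h2 : `|r| * ((n + ~~ s)./2.*2)%:R < (c n)%:R + 1 by rewrite natr1.
  rewrite -/(c n) in h1.
  rewrite ler_distl; nra.
pose b n := (c n.+1 - c n)%N.
have bsum n : \sum_(j < n) (-1) ^+ j * (b j)%:R = (-1) ^+ s * (c n)%:R :> K.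
  elim: n => [|n IHn]; first by rewrite big_ord0 c0 mulr0.
  rewrite big_ord_recr /= IHn.
  (* Either the sign at [n] is that of [r] and the sum telescopes, or [c] does not jump. *)
  have [ns|ns] := eqVneq (odd n) s.
    rewrite -[(-1) ^+ n]signr_odd ns -mulrDr -natrD; congr (_ * _%:R).
    by rewrite subnKC.
  suff cS : c n.+1 = c n by rewrite /b cS subnn mulr0 addr0.
  rewrite /c; congr (Num.truncn (_ * _.*2%:R)).
  by move: ns; case: (s); lia.
(* An increment of [c] is at most [|r|] plus twice the error [|r| + 1]. *)
exists b, (`|r| * 3 + 2); split => n.
  have := cB n; have := cB n.+1; rewrite !ler_distl /b natrB //.
  by rewrite -natr1; nra.
rewrite bsum.
have -> : r = (-1) ^+ s * `|r| by rewrite {1}[r]realEsign ?num_real.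
rewrite mulrCA -mulrBr normrM normr_sign mul1r.
apply: (le_trans (cB n)); rewrite ?normrM ?normr_sign ?mul1r ?normr_id; nra.
Qed.

End Cesaro.

(** * The complex realising [r] *)

Theorem theorem2p12 (R : idomainType) (K : realType) :
  noetherian R ->
  forall r : K, exists C : chain_complex R,
    admissible K C /\ Euler_char K C = r.
Proof.
move=> _ r; have [b [B [bB sumB]]] := bounded_nat_signed_mean r.
(* Rank 0 in negative degrees makes the chain modules vanish there. *)
pose d (n : int) := if n is Posz k then b k else 0%N.
pose C := zero_complex R d.
have rankC n : module_rank (homology C n%:Z) = b n.
  have [e [e_span e_free]] := zero_complex_homology R d n%:Z.
  exact: module_rank_free e_span e_free.
have cvg_ranks : cesaro_mul (signed_ranks K C) @ \oo --> r.
  (* The mean of the first [n.+1] signed ranks is [r] plus the bounded error [u n] divided by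
     [n.+1]. *)
  pose u n := \sum_(j < n.+1) (-1) ^+ j * (b j)%:R - n.+1%:R * r.
  have uB n : `|u n| <= B := sumB n.+1.
  rewrite -[r]addr0 (_ : cesaro_mul _ = fun n => r + n.+1%:R^-1 * u n).
    by apply: cvgD; [exact: cvg_cst | exact: bounded_div_cvg0 uB].
  apply/funext => n; rewrite cesaro_mulE mulrBr mulKf ?pnatr_eq0 // addrC subrK.
  by congr (_ * _); apply: eq_bigr => j _; rewrite /signed_ranks rankC.
have [Hranks Hlim_ranks] := cesaro_mul_Hlim cvg_ranks.
exists C; split=> //; split; first split=> // n.
- by case: n => // k _ x; exact: thinmx0.
- have [e [e_span _]] := zero_complex_homology R d n.
  by exists _, e.
(* The ranks are bounded, so the sequence tends to 0 before any averaging, and so does its first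
   mean. *)
apply: cesaro_mul_Hlim; apply: (@cvg_iter_cesaro_mul _ _ _ 0 1) => //=.
apply: (@bounded_div_cvg0 _ _ B) => n.
by rewrite rankC normr_nat.
Qed.
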